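(* For every $a\in\{14,15,\ldots,28\}\setminus\{21\}$, there is no equitable $2$-partition of the halved $10$-cube $\frac12 H(10)$ with a quotient matrix $\begin{pmatrix} a & b\\ c & d\end{pmatrix}$ having eigenvalue $13$ (i.e., with $a-c=d-b=13$).
   Context: The halved $10$-cube $\frac12 H(10)$ is the graph on the binary words of length $10$ with an even number of ones, two words adjacent iff they differ in exactly two positions; it is regular of degree $45$. An equitable $2$-partition is an ordered partition $(C_0,C_1)$ of the vertex set such that the number of neighbors in $C_j$ of any vertex of $C_i$ is a constant $S_{ij}$; $S=(S_{ij})$ is the quotient matrix, whose eigenvalues are $45$ and $a-c$. *)

(* Defs.v *)
From HB Require Import structures.
From mathcomp Require Import all_boot all_order all_algebra.

Set Implicit Arguments.
Unset Strict Implicit.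
Unset Printing Implicit Defensive.

Definition even_word (n : nat) (w : n.-tuple bool) : bool :=
  ~~ odd (count_mem true w).

Record halved_cube (n : nat) : predArgType :=
  HalvedCube { word_of : n.-tuple bool; _ : even_word word_of }.

HB.instance Definition _ (n : nat) := [isSub for @word_of n].
HB.instance Definition _ (n : nat) := [Finite of halved_cube n by <:].

Definition halved_cube_adj (n : nat) : rel (halved_cube n) :=
  fun u v => #|[set i : 'I_n | tnth (word_of u) i != tnth (word_of v) i]| == 2.

(* [adj] is the adjacency relation of a finite graph.  The cells are ordered
   by their index; [partition] makes them nonempty, disjoint and covering, while
   [injective C] excludes listing the same cell under two indices. *)
Definition equitable_partition (T : finType) (adj : rel T) (k : nat)
    (C : 'I_k -> {set T}) (S : 'M[nat]_k) : Prop :=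
  [/\ injective C,
      partition [set C i | i : 'I_k] [set: T] &
      forall (i j : 'I_k) (x : T), x \in C i ->
        #|[set y in C j | adj x y]| = S i j].

(* Main.v *)
(** Let [c = a - 13], [f] the indicator of the first cell and [h = 32 f - c], an
    eigenfunction for the eigenvalue 13.  Identifying words with subsets of
    the ten coordinates, the Walsh characters with eigenvalue 13 are those of
    weight 2 or 8, which agree in complementary pairs on even words; hence
    [h] is a quadratic form [sum q_ij y_i y_j] in signs, and Parseval gives
    [sum q_ij^2 = c (32 - c)].  At a word [v] of the second cell put
    [p_ij = q_ij v_i v_j], with row sums [s_i], and [t_ij = f (v + e_i + e_j)].
    Comparing [h] at [v] and [v + e_i + e_j] gives
    [s_i + s_j - 2 p_ij = - 16 t_ij], so the graph [t] determines [p] through its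
    degrees, [3 s_i = c - 8 deg_i].  As [t_ij^2 = t_ij], Parseval turns into
    [32 * sum deg_i^2 = 144 c + 11 c^2], which forces [8 | c]. *)
Require Import Defs.
From HB Require Import structures.
From mathcomp Require Import all_boot all_order all_algebra.
From mathcomp Require Import ring lra zify.

Set Implicit Arguments.
Unset Strict Implicit.
Unset Printing Implicit Defensive.

Import Order.TTheory GRing.Theory Num.Theory.
Local Open Scope ring_scope.

(** * Symmetric differences and two-element subsets *)

Definition symdiff (T : finType) (A B : {set T}) : {set T} :=
  [set i | (i \in A) (+) (i \in B)].

Lemma symdiffE (T : finType) (A B : {set T}) (i : T) :
  (i \in symdiff A B) = (i \in A) (+) (i \in B).
Proof. by rewrite inE. Qed.

Lemma symdiffK (T : finType) (A : {set T}) : involutive (symdiff A).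
Proof. by move=> B; apply/setP => i; rewrite !symdiffE addKb. Qed.

Lemma symdiffC (T : finType) (A B : {set T}) : symdiff A B = symdiff B A.
Proof. by apply/setP => i; rewrite !symdiffE addbC. Qed.

Lemma odd_symdiff (T : finType) (A B : {set T}) :
  odd #|symdiff A B| = odd #|A| (+) odd #|B|.
Proof.
have -> : symdiff A B = (A :\: B) :|: (B :\: A).
  by apply/setP => i; rewrite !inE; do 2 case: (_ \in _).
rewrite cardsU (_ : _ :&: _ = set0) ?cards0 ?subn0; last first.
  by apply/setP => i; rewrite !inE; do 2 case: (_ \in _).
rewrite -(cardsID B A) -(cardsID A B) (setIC B A) !oddD.
by do 3 case: (odd _).
Qed.

(** Each two-element set comes from two ordered pairs; this turns sums over weight-2 characters into
    sums over matrix entries. *)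
Lemma sum_pairs (T : finType) (V : nmodType) (F : {set T} -> V) :
  (\sum_(A : {set T} | #|A| == 2%N) F A) *+ 2
    = \sum_i \sum_(j | j != i) F [set i; j].
Proof.
transitivity (\sum_(A : {set T} | #|A| == 2%N) \sum_(i in A) \sum_(j in A :\ i) F A).
  rewrite -sumrMnl; apply: eq_bigr => A /eqP cA.
  rewrite (eq_bigr (fun=> F A)) ?sumr_const ?cA // => i iA.
  have c1 : #|A :\ i| = 1%N by move: (cardsD1 i A); rewrite iA cA; lia.
  by rewrite sumr_const c1.
rewrite (exchange_big_dep predT) //=; apply: eq_bigr => i _.
rewrite (exchange_big_dep (fun j => j != i)) /=; last first.
  by move=> A j _; rewrite !inE => /andP[].
apply: eq_bigr => j ji; rewrite (big_pred1 [set i; j]) // => A.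
rewrite /= !inE; apply/idP/eqP => [/and3P[/andP[/eqP cA iA] _ jA] | ->].
  apply/esym/eqP; rewrite eqEcard cA cards2 eq_sym ji andbT.
  by apply/subsetP => k; rewrite !inE => /orP[] /eqP->.
by rewrite cards2 [i == j]eq_sym !inE !eqxx orbT ji.
Qed.

(** * Fourier analysis on the power set *)

Section Walsh.

Variable T : finType.
Implicit Types A B X Y : {set T}.

Definition walsh A X : rat := (-1) ^+ #|A :&: X|.

Lemma walshC A X : walsh A X = walsh X A.
Proof. by rewrite /walsh setIC. Qed.

Lemma walsh_prod A X : walsh A X = \prod_(i in A) (-1) ^+ (i \in X).
Proof.
rewrite -[RHS]/(\prod_(i in A) (-1) ^+ _) prodrXr /walsh; congr (_ ^+ _).
rewrite -sum1_card big_mkcond [RHS]big_mkcond /=; apply: eq_bigr => i _.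
by rewrite inE; do 2 case: (_ \in _).
Qed.

Lemma walsh_symdiff A X Y : walsh A (symdiff X Y) = walsh A X * walsh A Y.
Proof.
rewrite !walsh_prod -big_split /=; apply: eq_bigr => i _.
by rewrite symdiffE signr_addb.
Qed.

Lemma walsh_pair i j X :
  i != j -> walsh [set i; j] X = (-1) ^+ (i \in X) * (-1) ^+ (j \in X).
Proof. by move=> ij; rewrite walsh_prod big_setU1 ?inE //= big_set1. Qed.

Lemma walshT X : walsh setT X = (-1) ^+ odd #|X|.
Proof. by rewrite /walsh setTI signr_odd. Qed.

(** The two characters multiply to the full one, which is the parity sign of [X]. *)
Lemma walsh_setC A X : ~~ odd #|X| -> walsh (~: A) X = walsh A X.
Proof.
move=> eX; apply/(@mulfI _ (walsh A X)); first by rewrite signr_eq0.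
rewrite !(walshC _ X) -walsh_symdiff -expr2 sqrr_sign walshC.
rewrite (_ : symdiff _ _ = setT) ?walshT ?(negbTE eX) //.
by apply/setP => i; rewrite !inE addbN addbb.
Qed.

Lemma walsh_sum X : \sum_A walsh A X = (X == set0)%:R * 2 ^+ #|T|.
Proof.
transitivity (\prod_(i : T) ((-1) ^+ (i \in X) + 1) : rat).
  rewrite bigA_distr; apply: eq_bigr => A _.
  by rewrite walsh_prod big_mkcond.
case: eqVneq => [-> | /set0Pn[i iX]].
  by under eq_bigr do rewrite inE; rewrite prodr_const mul1r.
by rewrite (bigD1 i) //= iX addNr !mul0r.
Qed.

Lemma walsh_orth X Y :
  \sum_A walsh A X * walsh A Y = (X == Y)%:R * 2 ^+ #|T|.
Proof.
under eq_bigr do rewrite -walsh_symdiff.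
rewrite walsh_sum; congr (_%:R * _); congr nat_of_bool.
apply/eqP/eqP => [XY0 | ->]; last by apply/setP => i; rewrite !inE addbb.
by rewrite -[Y](symdiffK X) XY0; apply/setP => i; rewrite !inE addbF.
Qed.

(** The evenness indicator is [(1 + walsh X setT) / 2], and a nontrivial character sums to zero. *)
Lemma sum_even : (0 < #|T|)%N ->
  \sum_(X : {set T}) (~~ odd #|X|)%:R = 2 ^+ #|T|.-1 :> rat.
Proof.
move=> T_gt0.
transitivity (\sum_(X : {set T}) (2^-1 + walsh X setT / 2) : rat).
  by apply: eq_bigr => X _; rewrite walshC walshT; case: odd => /=; lra.
rewrite big_split /= -mulr_suml walsh_sum sumr_const.
rewrite -cards_eq0 cardsT eqn0Ngt T_gt0 mul0r mul0r addr0.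
rewrite -cardsT -powersetT card_powerset cardsT -[LHS]mulr_natl natrX.
by rewrite -{1}(prednK T_gt0) exprSr mulfK.
Qed.

Definition fourier (h : {set T} -> rat) A : rat := \sum_X h X * walsh A X.

Lemma fourier_inversion h X :
  \sum_A fourier h A * walsh A X = 2 ^+ #|T| * h X.
Proof.
under eq_bigr do rewrite mulr_suml.
rewrite exchange_big /=.
under eq_bigr do [under eq_bigr do rewrite -mulrA; rewrite -mulr_sumr walsh_orth].
rewrite (bigD1 X) //= eqxx mul1r mulrC big1 ?addr0 // => Y neYX.
by rewrite (negbTE neYX) mul0r mulr0.
Qed.

(** This computes the eigenvalue of the distance-2 graph on the character [A]: in the square of the
    sum of the signs [u i], the diagonal contributes [#|T|] and the rest is the sum over ordered
    pairs. *)
Lemma walsh_pair_sum A :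
  (\sum_(B : {set T} | #|B| == 2%N) walsh A B) *+ 2
    = (#|T|%:R - #|A|%:R *+ 2) ^+ 2 - #|T|%:R.
Proof.
pose u i : rat := (-1) ^+ (i \in A).
have u1 i : u i * u i = 1 by rewrite -expr2 sqrr_sign.
have sumu : \sum_i u i = #|T|%:R - #|A|%:R *+ 2.
  transitivity (\sum_i (1 - (i \in A)%:R *+ 2) : rat).
    by apply: eq_bigr => i _; rewrite /u; case: (i \in A) => /=; lra.
  rewrite sumrB sumr_const sumrMnl; congr (_ - _ *+ 2).
  by rewrite -natr_sum -sum1_card [in RHS]big_mkcond.
rewrite sum_pairs -sumu expr2 mulr_suml.
rewrite -[X in _ - X](sumr_const T (1 : rat)) -sumrB; apply: eq_bigr => i _.
rewrite [X in _ * X](bigD1 i) //= mulrDr u1 addrAC subrr add0r mulr_sumr.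
by apply: eq_bigr => j ji; rewrite walshC walsh_pair // eq_sym.
Qed.

(** Translating by [B] multiplies the coefficient at [A] by [walsh A B], so characters diagonalise
    the adjacency operator. *)
Lemma fourier_pair_shift h A :
  fourier (fun X => \sum_(B : {set T} | #|B| == 2%N) h (symdiff X B)) A
    = (\sum_(B : {set T} | #|B| == 2%N) walsh A B) * fourier h A.
Proof.
rewrite /fourier; under eq_bigr do rewrite mulr_suml.
rewrite exchange_big mulr_suml /=; apply: eq_bigr => B _.
rewrite mulr_sumr (reindex_inj (can_inj (symdiffK B))) /=.
apply: eq_bigr => X _.
by rewrite (symdiffC _ B) symdiffK walsh_symdiff; ring.
Qed.

End Walsh.

(** * Quadratic forms in signs and the degree identity *)

Lemma sum_sign_pair (T : finType) (k l : T) (f : T -> rat) : k != l ->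
  \sum_j f j * (-1) ^+ (j \in [set k; l]) = \sum_j f j - (f k + f l) *+ 2.
Proof.
move=> kl; rewrite (bigD1 k) //= (bigD1 l) 1?eq_sym //=.
rewrite [in RHS](bigD1 k) //= [in RHS](bigD1 l) 1?eq_sym //=.
rewrite !inE !eqxx orbT (eq_bigr f); first by ring.
by move=> j /andP[jk jl]; rewrite !inE (negbTE jk) (negbTE jl) mulr1.
Qed.

(** Only entries with exactly one index in [{k, l}] change sign. The two rows and two columns also
    cover [p k l] and [p l k], each twice, hence the correction by 8. *)
Lemma flip_pair_form (T : finType) (p : T -> T -> rat) (k l : T) : k != l ->
  (forall i, p i i = 0) -> (forall i j, p i j = p j i) ->
  \sum_i \sum_j p i j * ((-1) ^+ (i \in [set k; l]) * (-1) ^+ (j \in [set k; l]))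
    = \sum_i \sum_j p i j - (\sum_j p k j + \sum_j p l j) *+ 4 + p k l *+ 8.
Proof.
move=> kl p0 pC.
transitivity (\sum_i (\sum_j p i j - (p i k + p i l) *+ 2)
                * (-1) ^+ (i \in [set k; l])).
  apply: eq_bigr => i _; rewrite -sum_sign_pair // mulr_suml.
  by apply: eq_bigr => j _; rewrite mulrA mulrAC.
have colE m : \sum_i p i m = \sum_j p m j by apply: eq_bigr => i _; exact: pC.
rewrite sum_sign_pair // sumrB sumrMnl big_split /= !p0 (pC l k) !colE.
ring.
Qed.

Lemma degree_square_sum (T : finType) (p : T -> T -> rat) (t : T -> T -> bool)
    (c : rat) :
  #|T| = 10%N ->
  (forall i, p i i = 0) -> (forall i j, p i j = p j i) ->
  (forall i, t i i = false) -> (forall i j, t i j = t j i) ->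
  (forall i j, i != j ->
     \sum_k p i k + \sum_k p j k - p i j *+ 2 = - 16 * (t i j)%:R) ->
  \sum_i \sum_j p i j = - 2 * c ->
  \sum_i \sum_j p i j ^+ 2 = 2 * c * (32 - c) ->
  32 * \sum_i (\sum_j (t i j)%:R) ^+ 2 = 144 * c + 11 * c ^+ 2.
Proof.
move=> cardT p0 pC t0 tC ptE sump sump2.
pose s i := \sum_k p i k; pose d i : rat := \sum_j (t i j)%:R.
(* The last term extends the off-diagonal relation to [i = j], where [p] and [t] vanish. *)
have pE i j : p i j *+ 2 = s i + s j + 16 * (t i j)%:R - 2 * ((i == j)%:R * s i).
  case: eqVneq => [<- | ij]; first by rewrite p0 t0 /=; ring.
  by have := ptE _ _ ij; rewrite -/(s i) -/(s j) mul0r mulr0; lra.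
have sum_s : \sum_i s i = - 2 * c by [].
have sumdiag (f : T -> rat) i : \sum_j (i == j)%:R * f j = f i.
  rewrite (bigD1 i) //= eqxx mul1r big1 ?addr0 // => j ji.
  by rewrite eq_sym (negbTE ji) mul0r.
have sE i : 6 * s i = 2 * c - 16 * d i.
  have: s i *+ 2 = \sum_j (s i + s j + 16 * (t i j)%:R - 2 * ((i == j)%:R * s i)).
    by rewrite -sumrMnl; apply: eq_bigr => j _; rewrite pE.
  rewrite sumrB 2!big_split /= -!mulr_sumr sum_s sumr_const cardT.
  by rewrite (sumdiag (fun=> s i)) -/(d i); lra.
have sum_d : \sum_i d i = 2 * c.
  have: \sum_i 6 * s i = \sum_i (2 * c - 16 * d i) by apply: eq_bigr.
  rewrite sumrB -!mulr_sumr sum_s sumr_const cardT; lra.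
have sum_ps : \sum_i \sum_j p i j * (s i + s j) = \sum_i s i ^+ 2 *+ 2.
  under eq_bigr do [under eq_bigr do rewrite mulrDr; rewrite big_split /=].
  rewrite big_split /= [X in _ + X]exchange_big -big_split.
  apply: eq_bigr => i _ /=; rewrite -!mulr_suml.
  have -> : \sum_j p j i = s i by apply: eq_bigr => j _; exact: pC.
  by rewrite mulr2n -expr2.
have sum_ts : \sum_i \sum_j (t i j)%:R * (s i + s j) = \sum_i d i * s i *+ 2.
  under eq_bigr do [under eq_bigr do rewrite mulrDr; rewrite big_split /=].
  rewrite big_split /= [X in _ + X]exchange_big -big_split.
  apply: eq_bigr => i _ /=; rewrite -!mulr_suml.
  have -> : \sum_j (t j i)%:R = d i by apply: eq_bigr => j _; rewrite tC.
  by rewrite mulr2n.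
(* Multiply [pE] by [t i j], which equals its own square and kills the diagonal term. *)
have sum_pt : \sum_i \sum_j p i j * (t i j)%:R = \sum_i d i * s i + 16 * c.
  have: (\sum_i \sum_j p i j * (t i j)%:R) *+ 2
      = \sum_i \sum_j ((t i j)%:R * (s i + s j) + 16 * (t i j)%:R).
    rewrite -sumrMnl; apply: eq_bigr => i _.
    rewrite -sumrMnl; apply: eq_bigr => j _.
    rewrite -mulrnAl pE; case: eqVneq => [<- | _]; first by rewrite t0 /=; ring.
    by case: (t i j); rewrite /=; ring.
  under [RHS]eq_bigr do rewrite big_split -mulr_sumr /=.
  rewrite big_split /= sum_ts -mulr_sumr sum_d sumrMnl; lra.
(* Multiplying [pE] by [p i j] likewise kills the diagonal term; what remains is expressed through
   [c] and the sum of the [d i ^+ 2]. *)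
have sum_pp : (\sum_i \sum_j p i j ^+ 2) *+ 2
    = \sum_i \sum_j (p i j * (s i + s j) + 16 * (p i j * (t i j)%:R)).
  rewrite -sumrMnl; apply: eq_bigr => i _.
  rewrite -sumrMnl; apply: eq_bigr => j _.
  rewrite expr2 -mulrnAr pE; case: eqVneq => [<- | _]; first by rewrite p0; ring.
  by rewrite /=; ring.
move: sum_pp; under [RHS]eq_bigr do rewrite big_split -mulr_sumr /=.
rewrite big_split /= sum_ps -mulr_sumr sum_pt sump2.
have sum_ds : \sum_i d i * s i = 2 / 3 * c ^+ 2 - 8 / 3 * \sum_i d i ^+ 2.
  transitivity (\sum_i (c / 3 * d i - 8 / 3 * d i ^+ 2)).
    apply: eq_bigr => i _.
    have -> : s i = c / 3 - 8 / 3 * d i by have := sE i; lra.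
    by field.
  by rewrite sumrB -!mulr_sumr sum_d; field.
have -> : \sum_i s i ^+ 2 *+ 2
    = 2 * (64 / 9 * (\sum_i d i ^+ 2) - 22 / 9 * c ^+ 2).
  rewrite sumrMnl.
  have -> : \sum_i s i ^+ 2 = \sum_i (c / 3 * s i - 8 / 3 * (d i * s i)).
    apply: eq_bigr => i _.
    have -> : s i = c / 3 - 8 / 3 * d i by have := sE i; lra.
    by field.
  by rewrite sumrB -!mulr_sumr sum_s sum_ds; field.
rewrite sum_ds; lra.
Qed.

(** * Eigenfunctions for 13 supported on even sets *)

Section Eigenfunction.

Variable T : finType.
Hypothesis cardT : #|T| = 10%N.
Variable h : {set T} -> rat.
Hypothesis h_odd : forall X : {set T}, odd #|X| -> h X = 0.
Hypothesis h_eigen :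
  forall X, \sum_(B : {set T} | #|B| == 2%N) h (symdiff X B) = 13 * h X.

(** A nonzero coefficient forces the eigenvalue of [A] to be 13, that is
    [(10 - 2 * #|A|) ^ 2 = 36]. *)
Lemma fourier_supp (A : {set T}) : #|A| != 2%N -> #|A| != 8%N -> fourier h A = 0.
Proof.
move=> A2 A8; have := fourier_pair_shift h A.
rewrite {1}/fourier; under eq_bigr do rewrite h_eigen -mulrA.
rewrite -mulr_sumr -/(fourier h A) => /eqP.
rewrite -subr_eq0 -mulrBl mulf_eq0 => /orP[|/eqP //].
have := walsh_pair_sum A; rewrite cardT.
move: (\sum_(_ | _) _) => e eE /eqP e13.
have : (#|A|%:R - 2) * (#|A|%:R - 8) = 0 :> rat by nra.
by move/eqP; rewrite mulf_eq0 !subr_eq0 !eqr_nat (negbTE A2) (negbTE A8).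
Qed.

Lemma fourier_setC A : fourier h (~: A) = fourier h A.
Proof.
apply: eq_bigr => X _; have [/h_odd -> | eX] := boolP (odd #|X|).
  by rewrite !mul0r.
by rewrite walsh_setC.
Qed.

(** Inversion divides by [2 ^ 10]; only 512 remains because each weight-8 term duplicates that of
    its weight-2 complement. *)
Definition pair_coef A := fourier h A / 512.

Lemma pair_expansion (X : {set T}) : ~~ odd #|X| ->
  h X = \sum_(A : {set T} | #|A| == 2%N) pair_coef A * walsh A X.
Proof.
move=> eX; have := fourier_inversion h X; rewrite cardT.
rewrite (bigID (fun A : {set _} => #|A| == 2%N)) /=.
rewrite [X in _ + X](bigID (fun A : {set _} => #|A| == 8%N)) /=.
have -> : \sum_(A : {set T} | (#|A| != 2%N) && (#|A| == 8%N))
      fourier h A * walsh A X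
    = \sum_(A : {set T} | #|A| == 2%N) fourier h A * walsh A X.
  rewrite (reindex_inj (@setC_inj T)) /=; apply: eq_big => A.
    by have := cardsC A; rewrite cardT; lia.
  by rewrite fourier_setC walsh_setC.
have -> : \sum_(A : {set T} | #|A| == 2%N) pair_coef A * walsh A X
    = (\sum_(A : {set T} | #|A| == 2%N) fourier h A * walsh A X) / 512.
  by rewrite mulr_suml; apply: eq_bigr => A _; rewrite mulrAC.
rewrite [X in _ + (_ + X)]big1 => [|A /andP[A2 A8]]; last first.
  by rewrite fourier_supp ?mul0r.
lra.
Qed.

Lemma pair_parseval :
  512 * \sum_(A : {set T} | #|A| == 2%N) pair_coef A ^+ 2 = \sum_X h X ^+ 2.
Proof.
transitivity (\sum_(A : {set T} | #|A| == 2%N)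
                \sum_X pair_coef A * (h X * walsh A X)).
  rewrite mulr_sumr; apply: eq_bigr => A _.
  by rewrite -mulr_sumr expr2 mulrCA [512 * _]mulrC divfK ?pnatr_eq0.
rewrite exchange_big; apply: eq_bigr => X _ /=.
have [/h_odd -> | eX] := boolP (odd #|X|).
  by rewrite big1 => [|A _]; rewrite ?(mul0r, mulr0, expr0n).
under eq_bigr do rewrite mulrCA.
by rewrite -mulr_sumr -pair_expansion.
Qed.

Lemma sum_eigenfunction : \sum_X h X = 0.
Proof.
have <- : fourier h set0 = \sum_X h X.
  by apply: eq_bigr => X _; rewrite /walsh set0I cards0 mulr1.
by rewrite fourier_supp ?cards0.
Qed.

End Eigenfunction.

(** * From a two-valued eigenfunction to an integer identity *)

Lemma two_valued_eigenfunction (T : finType) (g : {set T} -> bool) (c : nat)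
    (t : {set T} -> T -> T -> bool
       := fun X i j => (i != j) && g (symdiff X [set i; j])) (X : {set T}) :
  #|T| = 10%N ->
  (forall Y : {set T}, ~~ odd #|Y| ->
    (\sum_(B : {set T} | #|B| == 2%N) g (symdiff Y B) = 13 * g Y + c)%N) ->
  ~~ odd #|X| -> ~~ g X ->
  (32 * \sum_i (\sum_j t X i j) ^ 2 = 144 * c + 11 * c ^ 2)%N.
Proof.
move=> c10 gE eX gX.
(* Here 32 is [45 - 13], so that the constant term [c] in the hypothesis on [g] cancels. *)
pose h (Y : {set T}) : rat := if odd #|Y| then 0 else 32 * (g Y)%:R - c%:R.
have odd2 (Y B : {set T}) : #|B| == 2%N -> odd #|symdiff Y B| = odd #|Y|.
  by move=> /eqP B2; rewrite odd_symdiff B2 addbF.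
have h_odd (Y : {set T}) : odd #|Y| -> h Y = 0 by rewrite /h => ->.
have h_eigen Y : \sum_(B : {set T} | #|B| == 2%N) h (symdiff Y B) = 13 * h Y.
  have [oY | eY] := boolP (odd #|Y|).
    by rewrite h_odd // mulr0 big1 // => B B2; rewrite h_odd // odd2.
  under eq_bigr => B B2 do rewrite /h odd2 // (negbTE eY).
  rewrite sumrB -mulr_sumr -natr_sum gE // sumr_const /h (negbTE eY).
  have -> : #|[pred B : {set T} | #|B| == 2%N]| = 45%N.
    by rewrite -[LHS]cardsE card_draws c10.
  rewrite natrD natrM; lra.
pose q := pair_coef h.
(* The character value moves the origin to [X]: flipping a set [B] of coordinates now only changes
   signs in the form. *)
pose p i j : rat := if i == j then 0 else q [set i; j] * walsh [set i; j] X.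
have p0 i : p i i = 0 by rewrite /p eqxx.
have pC i j : p i j = p j i by rewrite /p eq_sym setUC.
have t0 i : t X i i = false by rewrite /t eqxx.
have tC i j : t X i j = t X j i by rewrite /t eq_sym setUC.
have hflip (B : {set T}) : ~~ odd #|B| -> h (symdiff X B) *+ 2
    = \sum_i \sum_j p i j * ((-1) ^+ (i \in B) * (-1) ^+ (j \in B)).
  move=> eB; rewrite (pair_expansion c10 h_odd h_eigen) ?odd_symdiff; last first.
    by rewrite (negbTE eX).
  rewrite sum_pairs; apply: eq_bigr => i _.
  rewrite [RHS](bigD1 i) //= p0 mul0r add0r; apply: eq_bigr => j ji.
  rewrite walsh_symdiff (@walsh_pair _ _ _ B) 1?eq_sym //.
  by rewrite /p eq_sym (negbTE ji) mulrA.
have hX : h X = - c%:R by rewrite /h (negbTE eX) (negbTE gX) mulr0 sub0r.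
have sump : \sum_i \sum_j p i j = - 2 * c%:R.
  have := hflip set0; rewrite cards0 => /(_ isT).
  rewrite (_ : symdiff X set0 = X); last by apply/setP => i; rewrite !inE addbF.
  rewrite hX; under eq_bigr do under eq_bigr do rewrite !inE !mulr1.
  by move=> <-; lra.
(* Compare the form at [[set i; j]] with its value at the empty set; [h] there is
   [32 * t X i j - c]. *)
have ptE i j : i != j ->
    \sum_k p i k + \sum_k p j k - p i j *+ 2 = - 16 * (t X i j)%:R.
  move=> ij; have c2 : #|[set i; j]| == 2%N by rewrite cards2 ij.
  have := hflip [set i; j]; rewrite (eqP c2) flip_pair_form // sump => /(_ isT).
  by rewrite /h odd2 // (negbTE eX) /t ij /=; lra.
have sumq : \sum_(A : {set T} | #|A| == 2%N) q A ^+ 2 = c%:R * (32 - c%:R).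
  have parseval := pair_parseval c10 h_odd h_eigen.
  (* On even sets [h] takes only the values [32 - c] and [- c], the roots of this quadratic; its
     linear term then sums to zero. *)
  have h2 Y : h Y ^+ 2
      = (32 - 2 * c%:R) * h Y + c%:R * (32 - c%:R) * (~~ odd #|Y|)%:R.
    by rewrite /h; case: odd; case: (g Y) => /=; ring.
  have sumh2 : \sum_Y h Y ^+ 2 = 512 * (c%:R * (32 - c%:R)).
    under eq_bigr do rewrite h2.
    rewrite big_split -!mulr_sumr /= (sum_eigenfunction c10 h_eigen) mulr0 add0r.
    rewrite sum_even; last by rewrite c10.
    rewrite c10 -natrX [RHS]mulrC.
    congr (_ * _%:R).
  apply: (@mulfI _ 512); first by rewrite pnatr_eq0.
  exact: etrans parseval sumh2.
have sump2 : \sum_i \sum_j p i j ^+ 2 = 2 * c%:R * (32 - c%:R).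
  rewrite -mulrA -sumq mulr_natl sum_pairs; apply: eq_bigr => i _.
  rewrite (bigD1 i) //= p0 expr0n add0r; apply: eq_bigr => j ji.
  by rewrite /p eq_sym (negbTE ji) exprMn sqrr_sign mulr1.
have := degree_square_sum c10 p0 pC t0 tC ptE sump sump2.
have -> : \sum_i (\sum_j (t X i j)%:R) ^+ 2
    = (\sum_i (\sum_j t X i j) ^ 2)%N%:R :> rat.
  by rewrite natr_sum; apply: eq_bigr => i _; rewrite natrX natr_sum.
by rewrite -natrX -!natrM -natrD => /eqP; rewrite eqr_nat => /eqP.
Qed.

(** * Words of the halved cube as even subsets *)

Section HalvedCubeOnes.

Variable n : nat.
Implicit Types x y : halved_cube n.

Definition ones x : {set 'I_n} := [set i | tnth (word_of x) i].

Lemma ones_inj : injective ones.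
Proof.
move=> x y /setP xy; apply/val_inj/eq_from_tnth => i.
by have := xy i; rewrite !inE.
Qed.

Lemma count_tuple_ones (w : n.-tuple bool) :
  count_mem true w = #|[set i | tnth w i]|.
Proof.
rewrite -sum1_count -sum1_card big_tuple; apply: eq_bigl => i.
by rewrite inE; case: (tnth w i).
Qed.

Lemma even_ones x : ~~ odd #|ones x|.
Proof. by rewrite -count_tuple_ones; case: x. Qed.

Lemma onesP (X : {set 'I_n}) : ~~ odd #|X| -> exists x, ones x = X.
Proof.
move=> eX; pose w := [tuple i \in X | i < n].
have wE : [set i | tnth w i] = X by apply/setP => i; rewrite inE tnth_mktuple.
have ew : even_word w by rewrite /even_word count_tuple_ones wE.
by exists (HalvedCube ew).
Qed.

Lemma halved_cube_adjE x y :
  halved_cube_adj x y = (#|symdiff (ones x) (ones y)| == 2%N).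
Proof.
rewrite /halved_cube_adj; congr (_ == _); apply: eq_card => i.
by rewrite !inE negb_eqb.
Qed.

(** Changing two coordinates preserves parity, so every such set is again a vertex, by [onesP], and
    a unique one, by [ones_inj]. *)
Lemma sum_adj (F : {set 'I_n} -> nat) x :
  (\sum_(y | halved_cube_adj x y) F (ones y)
     = \sum_(B : {set 'I_n} | #|B| == 2%N) F (symdiff (ones x) B))%N.
Proof.
rewrite [RHS](reindex_inj (can_inj (symdiffK (ones x)))) /=.
under [RHS]eq_bigr do rewrite symdiffK.
rewrite (partition_big ones (fun Y => #|symdiff (ones x) Y| == 2%N)) /=.
  apply: eq_bigr => Y xY2.
  have [|y yY] := @onesP Y.
    have := odd_symdiff (ones x) Y.
    by rewrite (eqP xY2) (negbTE (even_ones x)) /= => <-.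
  rewrite -{Y}yY in xY2 *.
  rewrite (big_pred1 y) // => z /=; rewrite (inj_eq ones_inj).
  by rewrite halved_cube_adjE; case: (eqVneq z y) => [->|]; rewrite ?xY2 ?andbF.
by move=> y; rewrite halved_cube_adjE.
Qed.

End HalvedCubeOnes.

(** * Divisibility by 32 and the conclusion *)

Lemma eight_of_square_sum (N c : nat) :
  (32 * N = 144 * c + 11 * c ^ 2)%N -> (0 < c < 16)%N -> c = 8%N.
Proof. by do 16 (case: c => [|c]; try lia). Qed.

Theorem theorem4 (a : nat) (ha : (14 <= a <= 28)%N) (ha21 : a <> 21%N) :
  ~ exists (C : 'I_2 -> {set halved_cube 10}) (S : 'M[nat]_2),
      [/\ equitable_partition (@halved_cube_adj 10) C S,
          S 0 0 = a &
          eigenvalue (map_mx (fun m : nat => m%:R : rat) S) 13%:R].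
Proof.
case=> C [S [[injC /and3P[/eqP covC trivC C_neq0] CS] S00 eigS]].
have ord2E (i : 'I_2) : i = 0 \/ i = 1.
  by case: i => [[|[|k]] k2] //; [left | right]; apply: val_inj.
have memC1 x : (x \in C 1) = (x \notin C 0).
  have [x0 | x0] := boolP (x \in C 0).
    have C01 : C 0 != C 1 by rewrite (inj_eq injC).
    have := trivIsetP trivC _ _ (imset_f C isT) (imset_f C isT) C01.
    by move/disjointFr => ->.
  have: x \in cover [set C i | i : 'I_2] by rewrite covC inE.
  rewrite /cover => /bigcupP[_ /imsetP[i _ ->]].
  by case: (ord2E i) => ->; rewrite ?(negbTE x0).
have CE i j x : x \in C i ->
    (\sum_(y | halved_cube_adj x y) (y \in C j) = S i j)%N.
  move=> xi; rewrite -(CS i j x xi) -sum1_card [RHS]big_mkcond [LHS]big_mkcond.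
  by apply: eq_bigr => y _; rewrite inE; do 2 case: (_ y) => //=.
have C_inh i : exists x, x \in C i.
  by apply/set0Pn; apply: contraNneq C_neq0 => <-; exact: imset_f.
(* The degree 45 counts the two-element subsets of ten coordinates. *)
have row_sum i : (S i 0%R + S i 1%R = 45)%N.
  have [x xi] := C_inh i; rewrite -!(CE i _ x xi) -big_split /=.
  rewrite (eq_bigr (fun=> 1%N)) => [|y _]; last by rewrite memC1; case: (y \in _).
  rewrite (sum_adj (fun=> 1%N)) sum1_card.
  by rewrite -[LHS]cardsE card_draws card_ord.
have S10 : S 1 0 = (a - 13)%N.
  have /eigenvalueP[v vS v_neq0] := eigS.
  have vSE j : v 0 0 * (S 0 j)%:R + v 0 1 * (S 1 j)%:R = 13 * v 0 j.
    have := congr1 (fun w : 'rV_2 => w 0 j) vS.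
    rewrite !mxE !big_ord_recl big_ord0 addr0 !mxE.
    by have -> : lift ord0 ord0 = 1 :> 'I_2 by apply: val_inj.
  have := vSE 0; have := vSE 1.
  have := congr1 (fun k : nat => k%:R : rat) (row_sum 0).
  have := congr1 (fun k : nat => k%:R : rat) (row_sum 1).
  rewrite !natrD S00 => r1 r0 v1 v0.
  (* Adding both coordinates of the left eigenvector equation gives [45 * (v 0 0 + v 0 1) = 13 * (v
     0 0 + v 0 1)]. *)
  have v01 : v 0 1 = - v 0 0 by nra.
  have vn : v 0 0 != 0.
    apply: contraNneq v_neq0 => v00; apply/eqP/rowP => i; rewrite mxE.
    by case: (ord2E i) => ->; rewrite ?v01 v00 ?oppr0.
  have : a%:R - (S 1 0)%:R = 13 :> rat.
    apply: (mulfI vn); rewrite v01 in v0; lra.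
  move/eqP; rewrite subr_eq -natrD eqr_nat => /eqP; lia.
(* The indicator of the first cell, extended by [false] to odd sets. *)
pose g (Y : {set 'I_10}) := Y \in [set ones y | y in C 0].
have gE x : g (ones x) = (x \in C 0) by rewrite /g mem_imset //; exact: ones_inj.
have [x x1] := C_inh 1.
have gsum (Y : {set 'I_10}) : ~~ odd #|Y| ->
    (\sum_(B : {set 'I_10} | #|B| == 2%N) g (symdiff Y B) = 13 * g Y + (a - 13))%N.
  case/onesP => y <-; rewrite -(sum_adj g) gE.
  under eq_bigr do rewrite gE.
  have [y0 | y0] := boolP (y \in C 0); first by rewrite (CE 0) // S00; lia.
  by rewrite (CE 1) ?memC1.
have := two_valued_eigenfunction (card_ord 10) gsum (even_ones x).
rewrite gE -memC1 => /(_ x1) /eight_of_square_sum c8.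
(* The only solution in this range is [a - 13 = 8], which is the excluded [a = 21]. *)
have c_bounds : (0 < a - 13 < 16)%N by lia.
by have := c8 c_bounds; lia.
Qed.
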